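(* Let $K$ be a field. Any finite family $R_1,\dots,R_m$ of standard graded toric rings over $K$ with $\operatorname{depth} R_i\ge 2$ for all $i=1,\dots,m$ is friendly.
   Context: A standard graded $K$-algebra is a commutative $\mathbb{N}$-graded $K$-algebra $R=\bigoplus_{i\ge 0}R_i$ with $R_0=K$, generated over $K$ by finitely many elements of degree $1$. A standard graded toric ring is a $K$-algebra $K[t^{a_1},\dots,t^{a_n}]$ generated by finitely many monomials $t^{a_1},\dots,t^{a_n}$ ($a_i$ integer vectors, the columns of an integer matrix) in a Laurent polynomial ring over $K$, which is standard graded with the generators $t^{a_i}$ in degree $1$. Depth is with respect to the maximal graded ideal. For a graded module $M$ and $a\in\mathbb{Z}$, $M(a)$ is the shifted module with $M(a)_k=M_{a+k}$. For a finitely generated graded $R$-module $M$, $M^\ast=\operatorname{Hom}_R(M,R)$ is graded by $M^\ast_i=\{\varphi\in\operatorname{Hom}_R(M,R):\varphi(M_k)\subseteq R_{k+i}\text{ for all }k\}$. Segre product: for standard graded $K$-algebras, $T=R_1\sharp\cdots\sharp R_m=\bigoplus_{j\ge 0}(R_1)_j\otimes_K\cdots\otimes_K(R_m)_j$, a standard graded $K$-algebra; for graded $R_i$-modules $M_i$, $M_1\sharp\cdots\sharp M_m=\bigoplus_{j\in\mathbb{Z}}(M_1)_j\otimes_K\cdots\otimes_K(M_m)_j$, a graded $T$-module, whose dual $(M_1\sharp\cdots\sharp M_m)^\ast$ is taken over $T$. Natural map: $\alpha: M_1^\ast\sharp\cdots\sharp M_m^\ast\to (M_1\sharp\cdots\sharp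 M_m)^\ast$ is the homogeneous $T$-linear map determined by $\alpha(\varphi_1\otimes\cdots\otimes\varphi_m)(x_1\otimes\cdots\otimes x_m)=\varphi_1(x_1)\otimes\cdots\otimes\varphi_m(x_m)$, for $\varphi_i\in (M_i^\ast)_j$ ($j$ common to all $i$) and $x_i\in (M_i)_k$ ($k$ common to all $i$). Friendly family: $R_1,\dots,R_m$ is called friendly if the natural map $\alpha:R_1(a_1)^\ast\sharp\cdots\sharp R_m(a_m)^\ast\to (R_1(a_1)\sharp\cdots\sharp R_m(a_m))^\ast$ is an isomorphism for all integers $a_1,\dots,a_m$. *)

(* Defs.v *)
From HB Require Import structures.
From mathcomp Require Import all_boot all_order all_algebra.
From mathcomp Require Import ring_quotient generic_quotient.
From mathcomp Require Import finmap monalg.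
From mathcomp Require Import boolp classical_sets functions.

Set Implicit Arguments.
Unset Strict Implicit.
Unset Printing Implicit Defensive.

Import GRing.Theory Num.Theory.
Local Open Scope quotient_scope.
Local Open Scope ring_scope.

Section LinearFacts.
Variables (K : fieldType) (U V W : lmodType K) (f : V -> W) (g : U -> V).
Hypotheses (fL : linear f) (gL : linear g).

Lemma lin0 : f 0 = 0.
Proof. by have := fL (-1) 0 0; rewrite scaler0 add0r scaleN1r addNr. Qed.
Lemma linD x y : f (x + y) = f x + f y.
Proof. by have := fL 1 x y; rewrite !scale1r. Qed.
Lemma linZ c x : f (c *: x) = c *: f x.
Proof. by have := fL c x 0; rewrite lin0 !addr0. Qed.
Lemma comb_linear (f' : V -> W) c : linear f' ->
  linear (fun x => c *: f x + f' x).
Proof.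
move=> fL' b x y; rewrite fL fL' !scalerDr !scalerA addrACA.
by rewrite [c * b]mulrC.
Qed.
Lemma comp_linear : linear (f \o g).
Proof. by move=> c x y; rewrite /= gL fL. Qed.

End LinearFacts.

HB.lock Definition lmul (K : fieldType) (d : nat) (g h : {malg K['cV[int]_d]})
    : {malg K['cV[int]_d]} :=
  \sum_(a <- msupp g) \sum_(b <- msupp h) << g@_a * h@_b *g a + b >>.

Section LaurentMul.
Variables (K : fieldType) (d : nat).
Local Notation lmul := (@lmul K d).
Local Notation L := {malg K['cV[int]_d]}.
Implicit Types g h : L.

Lemma lmulw (d1 d2 : {fset 'cV[int]_d}) g h :
  (msupp g `<=` d1)%fset -> (msupp h `<=` d2)%fset ->
  lmul g h = \sum_(a <- d1) \sum_(b <- d2) << g@_a * h@_b *g a + b >>.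
Proof.
move=> le_d1 le_d2; rewrite lmul.unlock (big_fset_incl _ le_d1) /=.
  apply/eq_bigr => a _; apply/big_fset_incl => // b _ /mcoeff_outdom ->.
  by rewrite mulr0 monalgU0.
move=> a _ /mcoeff_outdom ga.
by rewrite big1 // => b _; rewrite ga mul0r monalgU0.
Qed.

Lemma lmulC : commutative lmul.
Proof.
move=> g h; rewrite lmul.unlock exchange_big; apply: eq_bigr => a _.
by apply: eq_bigr => b _; rewrite mulrC addrC.
Qed.

Lemma lmulDl : left_distributive lmul +%R.
Proof.
move=> g1 g2 h.
pose D := (msupp g1 `|` msupp g2)%fset.
rewrite (@lmulw D (msupp h)) ?msuppD_le ?fsubset_refl //.
rewrite (@lmulw D (msupp h) g1) ?fsubsetUl ?fsubset_refl //.
rewrite (@lmulw D (msupp h) g2) ?fsubsetUr ?fsubset_refl //.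
rewrite -big_split /=; apply/eq_bigr => a _.
rewrite -big_split /=; apply/eq_bigr => b _.
by rewrite mcoeffD mulrDl monalgUD.
Qed.

Lemma lmulDr : right_distributive lmul +%R.
Proof. by move=> h g1 g2; rewrite lmulC lmulDl !(lmulC h). Qed.

Lemma lmul0g : left_zero 0 lmul.
Proof. by move=> g; rewrite lmul.unlock msupp0 big_seq_fset0. Qed.

Lemma lmulg0 : right_zero 0 lmul.
Proof. by move=> g; rewrite lmulC lmul0g. Qed.

Lemma lmulUU (c1 c2 : K) (a b : 'cV[int]_d) :
  lmul (<< c1 *g a >> : L) (<< c2 *g b >> : L) = << c1 * c2 *g a + b >> :> L.
Proof. by rewrite (lmulw msuppU_le msuppU_le) !big_seq_fset1 !mcoeffUU. Qed.

Lemma malg_ind (P : L -> Prop) :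
  P 0 -> (forall (c : K) (a : 'cV[int]_d) (g : L), P g -> P ((<< c *g a >> : L) + g)) ->
  forall g, P g.
Proof.
move=> P0 PD g; rewrite (monalgE g).
by elim: (msupp g : seq _) => [|a s IH]; rewrite ?big_nil // big_cons; apply: PD.
Qed.

Lemma lmulA : associative lmul.
Proof.
have DA1 u v g h : lmul u (lmul g h) = lmul (lmul u g) h ->
    lmul v (lmul g h) = lmul (lmul v g) h ->
    lmul (u + v) (lmul g h) = lmul (lmul (u + v) g) h.
  by move=> E1 E2; rewrite 3!lmulDl E1 E2.
have DA2 u v g h : lmul g (lmul u h) = lmul (lmul g u) h ->
    lmul g (lmul v h) = lmul (lmul g v) h ->
    lmul g (lmul (u + v) h) = lmul (lmul g (u + v)) h.
  by move=> E1 E2; rewrite lmulDl 2!lmulDr lmulDl E1 E2.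
have DA3 u v g h : lmul g (lmul h u) = lmul (lmul g h) u ->
    lmul g (lmul h v) = lmul (lmul g h) v ->
    lmul g (lmul h (u + v)) = lmul (lmul g h) (u + v).
  by move=> E1 E2; rewrite 3!lmulDr E1 E2.
move=> g1 g2 g3.
elim/malg_ind: g1 => [|c1 a1 g1 IH]; first by rewrite 3!lmul0g.
apply: DA1; last exact: IH.
elim/malg_ind: g2 {IH} => [|c2 a2 g2 IH].
  by rewrite lmul0g lmulg0 lmul0g.
apply: DA2; last exact: IH.
elim/malg_ind: g3 {IH} => [|c3 a3 g3 IH]; first by rewrite 3!lmulg0.
apply: DA3; last exact: IH.
rewrite (lmulUU c2 c3 a2 a3) (lmulUU c1 (c2 * c3) a1 (a2 + a3)) (lmulUU c1 c2 a1 a2).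
by rewrite (lmulUU (c1 * c2) c3 (a1 + a2) a3) mulrA addrA.
Qed.

Lemma lmul1g : left_id << 0 >> lmul.
Proof.
elim/malg_ind => [|c a g IH]; first by rewrite lmulg0.
by rewrite lmulDr IH lmulUU mul1r add0r.
Qed.

Lemma lone_neq0 : << 0 >> != 0 :> L.
Proof. by rewrite monalgU_eq0 oner_eq0. Qed.

Lemma scale_malgU (T : choiceType) (c x : K) (a : T) :
  c *: (<< x *g a >> : {malg K[T]}) = << c * x *g a >> :> {malg K[T]}.
Proof. by apply/malgP => k; rewrite mcoeffZ !mcoeffU mulrnAr. Qed.

Lemma lscaleAl c g h : c *: lmul g h = lmul (c *: g) h.
Proof.
have DA1 u v k : c *: lmul u k = lmul (c *: u) k ->
    c *: lmul v k = lmul (c *: v) k -> c *: lmul (u + v) k = lmul (c *: (u + v)) k.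
  by move=> E1 E2; rewrite scalerDr 2!lmulDl scalerDr E1 E2.
have DA2 u v k : c *: lmul k u = lmul (c *: k) u ->
    c *: lmul k v = lmul (c *: k) v -> c *: lmul k (u + v) = lmul (c *: k) (u + v).
  by move=> E1 E2; rewrite 2!lmulDr scalerDr E1 E2.
elim/malg_ind: g => [|c1 a1 g IH]; first by rewrite lmul0g scaler0 lmul0g.
apply: DA1; last exact: IH.
elim/malg_ind: h {IH} => [|c2 a2 h IH].
  by rewrite 2!lmulg0 scaler0.
apply: DA2; last exact: IH.
rewrite (lmulUU c1 c2 a1 a2) (scale_malgU c c1 a1) (lmulUU (c * c1) c2 a1 a2).
by rewrite (scale_malgU c (c1 * c2)) mulrA.
Qed.

End LaurentMul.

(* The group algebra K[Z^d]; {malg K[G]} itself only receives a product when G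
   is a monoid without nontrivial units, which excludes Z^d. *)
Definition laurent (K : fieldType) (d : nat) : Type := {malg K['cV[int]_d]}.

HB.instance Definition _ (K : fieldType) d :=
  GRing.Lmodule.copy (laurent K d) {malg K['cV[int]_d]}.
HB.instance Definition _ (K : fieldType) d :=
  GRing.Zmodule_isComNzRing.Build (laurent K d) (@lmulA K d) (@lmulC K d)
    (@lmul1g K d) (@lmulDl K d) (@lone_neq0 K d).
HB.instance Definition _ (K : fieldType) d :=
  GRing.Lmodule_isLalgebra.Build K (laurent K d) (@lscaleAl K d).
HB.instance Definition _ (K : fieldType) d :=
  GRing.Lalgebra_isComAlgebra.Build K (laurent K d).

(* The monomial t^a. *)
Definition lmon (K : fieldType) (d : nat) (a : 'cV[int]_d) : laurent K d :=
  << a >>.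

Lemma lmon0 (K : fieldType) d : lmon K (0 : 'cV[int]_d) = 1.
Proof. by []. Qed.

Lemma lmonD (K : fieldType) d (a b : 'cV[int]_d) :
  lmon K (a + b) = lmon K a * lmon K b.
Proof. by rewrite /lmon -[1 in LHS]mulr1 -lmulUU. Qed.

(* Z-graded commutative K-algebras; N-gradedness is part of [standard_graded]
   below. Indexing by int lets the shifts R(a) live in the same setting. *)
Record gradedAlg (K : fieldType) := GradedAlg {
  galg :> comAlgType K;
  hcomp : int -> submodClosed galg;
  hcomp1 : 1 \in hcomp 0;
  hcompM : forall i j x y,
    x \in hcomp i -> y \in hcomp j -> x * y \in hcomp (i + j);
  hcomp_span : forall x : galg, exists (s : seq int) (c : int -> galg),
    (forall j, c j \in hcomp j) /\ x = \sum_(j <- s) c j;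
  hcomp_direct : forall (s : seq int) (c : int -> galg),
    uniq s -> (forall j, c j \in hcomp j) -> \sum_(j <- s) c j = 0 ->
    forall j, j \in s -> c j = 0
}.

Definition in_subalg (K : fieldType) (A : comAlgType K) (s : seq A) (x : A) :=
  forall S : {pred A},
    GRing.subalg_closed S -> {subset s <= S} -> x \in S.

Definition standard_graded (K : fieldType) (R : gradedAlg K) : Prop :=
  [/\ forall j (x : R), j < 0 -> x \in hcomp R j -> x = 0,
      forall x : R, x \in hcomp R 0 -> exists c : K, x = c%:A
    & exists s : seq R,
        {subset s <= hcomp R 1} /\ forall x : R, in_subalg s x].

(* R is, up to isomorphism, the ring K[t^{a_1}, ..., t^{a_n}] with each t^{a_i}
   homogeneous of degree 1, where a_1, ..., a_n are the columns of a. *)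
Definition toric (K : fieldType) (R : gradedAlg K) : Prop :=
  exists (d n : nat) (a : 'M[int]_(d, n)) (f : {lrmorphism R -> laurent K d}),
    let gens := [seq lmon K (col i a) | i <- enum 'I_n] in
    [/\ injective f,
        forall y, (exists x, f x = y) <-> in_subalg gens y
      & forall i, exists2 x : R, x \in hcomp R 1 & f x = lmon K (col i a)].

Definition in_ideal (R : comNzRingType) (s : seq R) (x : R) : Prop :=
  exists c : 'I_(size s) -> R, x = \sum_(i < size s) c i * s`_i.

Definition regular_seq (R : comNzRingType) (s : seq R) : Prop :=
  (forall i, (i < size s)%N -> forall x : R,
     in_ideal (take i s) (s`_i * x) -> in_ideal (take i s) x)
  /\ ~ in_ideal s 1.

(* Membership in the maximal graded ideal, the sum of the R_j with j > 0. *)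
Definition in_maxideal (K : fieldType) (R : gradedAlg K) (x : R) : Prop :=
  exists (s : seq int) (c : int -> R),
    [/\ forall j, j \in s -> 0 < j, forall j, c j \in hcomp R j
      & x = \sum_(j <- s) c j].

(* depth R >= r, where depth R is the supremum of the lengths of the R-regular
   sequences contained in the maximal graded ideal. *)
Definition depth_ge (K : fieldType) (R : gradedAlg K) (r : nat) : Prop :=
  exists s : seq R,
    [/\ (r <= size s)%N, forall x, x \in s -> in_maxideal x & regular_seq s].

(* A graded algebra given by the family of its homogeneous components; this is
   the form in which duals and Segre products are built, and [zgalg_of] passes
   to it from a gradedAlg. The product is indexed by a proof of i + j = k, so
   that no transport along equalities between degrees is needed. *)
Record zgalg (K : fieldType) := ZGAlg {
  zcomp :> int -> lmodType K;
  zmul : forall i j k, i + j = k -> zcomp i -> zcomp j -> zcomp k;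
  zone : zcomp 0;
  zmul_linr : forall i j k (e : i + j = k) x, linear (zmul e x);
  zmulC : forall i j k (e : i + j = k) (e' : j + i = k) x y,
    zmul e x y = zmul e' y x;
  zmulA : forall i j k ij jk ijk (e1 : i + j = ij) (e2 : ij + k = ijk)
      (e3 : j + k = jk) (e4 : i + jk = ijk) x y z,
    zmul e2 (zmul e1 x y) z = zmul e4 x (zmul e3 y z);
  zmul1 : forall j (e : 0 + j = j) x, zmul e zone x = x
}.

Record zgmod (K : fieldType) (A : zgalg K) := ZGMod {
  mcomp :> int -> lmodType K;
  zact : forall i j k, i + j = k -> A i -> mcomp j -> mcomp k;
  zact_linl : forall i j k (e : i + j = k) y, linear ((zact e)^~ y);
  zact_linr : forall i j k (e : i + j = k) x, linear (zact e x);
  zactA : forall i j k ij jk ijk (e1 : i + j = ij) (e2 : ij + k = ijk)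
      (e3 : j + k = jk) (e4 : i + jk = ijk) x y z,
    zact e2 (zmul e1 x y) z = zact e4 x (zact e3 y z);
  zact1 : forall j (e : 0 + j = j) x, zact e (zone A) x = x
}.

Section OfGradedAlg.
Variables (K : fieldType) (R : gradedAlg K).

Definition hpiece (j : int) : Type := {x : R | x \in hcomp R j}.
HB.instance Definition _ j := [isSub of hpiece j for @sval _ _].
HB.instance Definition _ j := [Choice of hpiece j by <:].
HB.instance Definition _ j := [SubChoice_isSubLmodule of hpiece j by <:].

Lemma hmul_subproof i j k (e : i + j = k) (x : hpiece i) (y : hpiece j) :
  val x * val y \in hcomp R k.
Proof. by rewrite -e; apply: hcompM; exact: valP. Qed.

Definition hmul i j k (e : i + j = k) (x : hpiece i) (y : hpiece j) :
  hpiece k := Sub (val x * val y) (hmul_subproof e x y).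
Definition hone : hpiece 0 := Sub 1 (hcomp1 R).

Lemma hmul_linr i j k (e : i + j = k) x : linear (hmul e x).
Proof.
by move=> c y z; apply: val_inj => /=; rewrite mulrDr -scalerAr.
Qed.
Lemma hmulC i j k (e : i + j = k) (e' : j + i = k) x y :
  hmul e x y = hmul e' y x.
Proof. by apply: val_inj; rewrite /= mulrC. Qed.
Lemma hmulA i j k ij jk ijk (e1 : i + j = ij) (e2 : ij + k = ijk)
    (e3 : j + k = jk) (e4 : i + jk = ijk) x y z :
  hmul e2 (hmul e1 x y) z = hmul e4 x (hmul e3 y z).
Proof. by apply: val_inj; rewrite /= mulrA. Qed.
Lemma hmul1 j (e : 0 + j = j) x : hmul e hone x = x.
Proof. by apply: val_inj; rewrite /= mul1r. Qed.

Definition zgalg_of : zgalg K := ZGAlg hmul_linr hmulC hmulA hmul1.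

End OfGradedAlg.

Section Modules.
Variables (K : fieldType) (A : zgalg K).

Lemma zmul_linl i j k (e : i + j = k) (y : A j) : linear ((@zmul K A _ _ _ e)^~ y).
Proof.
have e' : j + i = k by rewrite addrC.
by move=> c x x'; rewrite !(zmulC e e') zmul_linr.
Qed.

Definition regular : zgmod A :=
  ZGMod zmul_linl (@zmul_linr K A) (@zmulA K A) (@zmul1 K A).

Section Shift.
Variables (M : zgmod A) (a : int).

Lemma shift_eq (i j k : int) : i + j = k -> i + (a + j) = a + k.
Proof. by move=> <-; rewrite addrCA. Qed.

Definition shift_act i j k (e : i + j = k) (x : A i) (y : M (a + j)) :
  M (a + k) := zact (shift_eq e) x y.

Lemma shift_linl i j k (e : i + j = k) y : linear ((shift_act e)^~ y).
Proof. exact: zact_linl. Qed.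
Lemma shift_linr i j k (e : i + j = k) x : linear (shift_act e x).
Proof. exact: zact_linr. Qed.
Lemma shift_actA i j k ij jk ijk (e1 : i + j = ij) (e2 : ij + k = ijk)
    (e3 : j + k = jk) (e4 : i + jk = ijk) x y z :
  shift_act e2 (zmul e1 x y) z = shift_act e4 x (shift_act e3 y z).
Proof. exact: zactA. Qed.

Lemma zact1_gen (N : zgmod A) j k (e : 0 + j = k) (e' : j = k) (x : N j) :
  zact e (zone A) x = ecast k (N k) e' x.
Proof. by case: k / e' e => e; exact: zact1. Qed.

Lemma shift_act1 j (e : 0 + j = j) x : shift_act e (zone A) x = x.
Proof. exact: (zact1_gen _ erefl). Qed.

Definition shift : zgmod A :=
  @ZGMod K A (fun j => M (a + j)) shift_act
    shift_linl shift_linr shift_actA shift_act1.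

End Shift.

Section Hom.
Variables (M N : zgmod A) (j : int).

Record zhom := ZHom {
  zhom_fun :> forall k, M k -> N (k + j);
  zhom_lin : forall k, linear (@zhom_fun k);
  zhom_act : forall i k l (e : i + k = l) (e' : i + (k + j) = l + j) x y,
    zhom_fun (zact e x y) = zact e' x (zhom_fun y)
}.

HB.instance Definition _ := gen_eqMixin zhom.
HB.instance Definition _ := gen_choiceMixin zhom.

Lemma zhomP (f g : zhom) : (forall k, f k =1 g k) -> f = g.
Proof.
case: f g => [f fl fa] [g gl ga] /= fg.
have {}fg : f = g by apply: functional_extensionality_dep => k; apply/funext/fg.
subst g; congr ZHom; exact: Prop_irrelevance.
Qed.

Lemma zact0 i k l (e : i + k = l) (x : A i) : zact e x (0 : N k) = 0.
Proof.
exact: (lin0 (zact_linr e x)).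
Qed.
Lemma zactD i k l (e : i + k = l) (x : A i) (y z : N k) :
  zact e x (y + z) = zact e x y + zact e x z.
Proof. exact: (linD (zact_linr e x)). Qed.
Lemma zactZ i k l (e : i + k = l) (x : A i) c (y : N k) :
  zact e x (c *: y) = c *: zact e x y.
Proof. exact: (linZ (zact_linr e x)). Qed.

Lemma zhom0_lin k : linear (fun _ : M k => 0 : N (k + j)).
Proof. by move=> c x y; rewrite scaler0 addr0. Qed.
Definition zhom0 : zhom.
Proof. by refine (ZHom zhom0_lin _) => *; rewrite zact0. Defined.

Definition zhom_comb (c : K) (f g : zhom) : zhom.
Proof.
refine (@ZHom (fun k x => c *: f k x + g k x) _ _).
- by move=> k; apply: comb_linear; exact: zhom_lin.
- by move=> i k l e e' x y; rewrite !(zhom_act _ e e') zactD zactZ.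
Defined.

Definition zhom_add (f g : zhom) : zhom := zhom_comb 1 f g.
Definition zhom_scale (c : K) (f : zhom) : zhom := zhom_comb c f zhom0.
Definition zhom_opp (f : zhom) : zhom := zhom_scale (-1) f.

Lemma zhom_addA : associative zhom_add.
Proof. by move=> f g h; apply: zhomP => k x /=; rewrite !scale1r addrA. Qed.
Lemma zhom_addC : commutative zhom_add.
Proof. by move=> f g; apply: zhomP => k x /=; rewrite !scale1r [f k x + _]addrC. Qed.
Lemma zhom_add0 : left_id zhom0 zhom_add.
Proof. by move=> f; apply: zhomP => k x /=; rewrite !scale1r add0r. Qed.
Lemma zhom_addN : left_inverse zhom0 zhom_opp zhom_add.
Proof.
by move=> f; apply: zhomP => k x /=; rewrite scale1r scaleN1r addr0 addNr.
Qed.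
HB.instance Definition _ :=
  GRing.isZmodule.Build zhom zhom_addA zhom_addC zhom_add0 zhom_addN.

Lemma zhomDE (f g : zhom) k x : (f + g) k x = f k x + g k x.
Proof. by rewrite /= scale1r. Qed.

Lemma zhom_scaleA a b (f : zhom) :
  zhom_scale a (zhom_scale b f) = zhom_scale (a * b) f.
Proof. by apply: zhomP => k x /=; rewrite !addr0 scalerA. Qed.
Lemma zhom_scale1 : left_id 1 zhom_scale.
Proof. by move=> f; apply: zhomP => k x /=; rewrite addr0 scale1r. Qed.
Lemma zhom_scaleDr : right_distributive zhom_scale +%R.
Proof.
move=> c f g; apply: zhomP => k x; rewrite zhomDE /=.
by rewrite !addr0 scale1r scalerDr.
Qed.
Lemma zhom_scaleDl f : {morph zhom_scale^~ f : a b / a + b}.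
Proof. by move=> a b; apply: zhomP => k x; rewrite zhomDE /= !addr0 scalerDl. Qed.
HB.instance Definition _ := GRing.Zmodule_isLmodule.Build K zhom
  zhom_scaleA zhom_scale1 zhom_scaleDr zhom_scaleDl.

Lemma zhomZE c (f : zhom) k x : (c *: f) k x = c *: f k x.
Proof. by rewrite /= addr0. Qed.

End Hom.

Section Dual.
Variable M : zgmod A.

Local Notation dcomp := (zhom M regular).

Lemma dual_eq (i j l k : int) : i + j = l -> i + (k + j) = k + l.
Proof. by move=> <-; rewrite addrCA. Qed.

(* The graded dual of M, with components M^*_j the homogeneous A-linear maps
   M -> A of degree j; their direct sum is Hom_A(M, A) when M is finitely
   generated. *)
Definition dual_act i j l (e : i + j = l) (r : A i) (f : dcomp j) : dcomp l.
Proof.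
refine (@ZHom M regular l (fun k x => zmul (dual_eq k e) r (f k x)) _ _).
- by move=> k c x y; rewrite zhom_lin (zmul_linr (dual_eq k e)).
- move=> i' k k' e1 e2 x y.
  have e3 : i' + (k + j) = k' + j by rewrite -e1 addrA.
  have e4 : i + i' = i' + i by rewrite addrC.
  have e5 : i' + i + (k + j) = k' + l by rewrite -e -e1 addrACA.
  rewrite (zhom_act f e1 e3) /=.
  rewrite -(zmulA (etrans e4 erefl) e5) (zmulC _ (erefl (i' + i))).
  exact: zmulA.
Defined.

Lemma dual_linl i j k (e : i + j = k) f : linear ((dual_act e)^~ f).
Proof.
move=> c r s; apply: zhomP => l x.
by rewrite zhomDE zhomZE /= zmul_linl.
Qed.
Lemma dual_linr i j k (e : i + j = k) r : linear (dual_act e r).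
Proof.
move=> c f g; apply: zhomP => l x.
have E h : dual_act e r h l x = zmul (dual_eq l e) r (h l x) by [].
by rewrite zhomDE zhomZE !E zhomDE zhomZE zmul_linr.
Qed.
Lemma dual_actA i j k ij jk ijk (e1 : i + j = ij) (e2 : ij + k = ijk)
    (e3 : j + k = jk) (e4 : i + jk = ijk) r s f :
  dual_act e2 (zmul e1 r s) f = dual_act e4 r (dual_act e3 s f).
Proof. by apply: zhomP => l x /=; exact: zmulA. Qed.
Lemma dual_act1 j (e : 0 + j = j) f : dual_act e (zone A) f = f.
Proof. by apply: zhomP => l x /=; exact: (@zact1_gen regular _ _ _ erefl). Qed.

Definition dual : zgmod A := ZGMod dual_linl dual_linr dual_actA dual_act1.

End Dual.
End Modules.

Section Tensor.
Variables (K : fieldType) (I : eqType) (V : I -> lmodType K).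
Local Notation F := {malg K[forall i, V i]}.

(* [dfwith v x] is the family v with its i-th entry replaced by x : V i. *)
Definition multilinear (W : lmodType K) (f : (forall i, V i) -> W) : Prop :=
  forall (v : forall i, V i) i (c : K) (x y : V i),
    f (dfwith v (c *: x + y)) = c *: f (dfwith v x) + f (dfwith v y).

(* The subspace of the free vector space on the product of the V i spanned by
   the relations of multilinearity. *)
Inductive tnull : F -> Prop :=
| tnull_rel (v : forall i, V i) i (c : K) (x y : V i) :
    tnull (<< dfwith v (c *: x + y) >>
             - (c *: << dfwith v x >> + << dfwith v y >>))
| tnull0 : tnull 0
| tnull_comb (c : K) g h : tnull g -> tnull h -> tnull (c *: g + h).

Definition tnull_pred : {pred F} := [pred g | `[< tnull g >]].

Lemma tnull_predP g : reflect (tnull g) (g \in tnull_pred).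
Proof. exact: asboolP. Qed.

Lemma tnull_zmod_closed : zmod_closed tnull_pred.
Proof.
split; first exact/tnull_predP/tnull0.
move=> g h /tnull_predP gN /tnull_predP hN; apply/tnull_predP.
by rewrite addrC -scaleN1r; apply: tnull_comb.
Qed.
HB.instance Definition _ :=
  GRing.isZmodClosed.Build F tnull_pred tnull_zmod_closed.

Definition tens : Type := Quotient.quot tnull_pred.
HB.instance Definition _ := GRing.Zmodule.copy tens (Quotient.quot tnull_pred).

Definition tpi (g : F) : tens := \pi_(Quotient.quot tnull_pred) g.

Lemma tpi_eq g h : tpi g = tpi h <-> tnull (g - h).
Proof.
split=> [gh|gh]; last by apply/eqP; rewrite -Quotient.idealrBE; apply/tnull_predP.
by apply/tnull_predP; rewrite Quotient.idealrBE; apply/eqP.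
Qed.

Lemma tpiD g h : tpi (g + h) = tpi g + tpi h.
Proof. exact: Quotient.pi_add. Qed.

Lemma tpi_surj t : exists g, t = tpi g.
Proof. by exists (repr t); rewrite /tpi reprK. Qed.

Definition tscale (c : K) (t : tens) : tens :=
  tpi (c *: repr (t : Quotient.quot tnull_pred)).

Lemma tscaleE c g : tscale c (tpi g) = tpi (c *: g).
Proof.
apply/tpi_eq; rewrite -scalerBr -[_ *: _]addr0.
apply: tnull_comb; last exact: tnull0.
by apply/tpi_eq; rewrite /tpi reprK.
Qed.

Lemma tscaleA a b t : tscale a (tscale b t) = tscale (a * b) t.
Proof. by have [g ->] := tpi_surj t; rewrite !tscaleE scalerA. Qed.
Lemma tscale1 : left_id 1 tscale.
Proof. by move=> t; have [g ->] := tpi_surj t; rewrite tscaleE scale1r. Qed.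
Lemma tscaleDr : right_distributive tscale +%R.
Proof.
move=> c t u; have [g ->] := tpi_surj t; have [h ->] := tpi_surj u.
by rewrite -tpiD !tscaleE -tpiD scalerDr.
Qed.
Lemma tscaleDl t : {morph tscale^~ t : a b / a + b}.
Proof.
by move=> a b; have [g ->] := tpi_surj t; rewrite !tscaleE -tpiD scalerDl.
Qed.
HB.instance Definition _ := GRing.Zmodule_isLmodule.Build K tens
  tscaleA tscale1 tscaleDr tscaleDl.

Lemma tpi_linear : linear tpi.
Proof. by move=> c g h; rewrite tpiD -tscaleE. Qed.
HB.instance Definition _ := GRing.isLinear.Build K F tens *:%R tpi tpi_linear.

Definition tpure (v : forall i, V i) : tens := tpi << v >>.

Lemma tpure_multilinear : multilinear tpure.
Proof.
move=> v i c x y; rewrite /tpure -linearZ -raddfD.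
exact/tpi_eq/tnull_rel.
Qed.

Lemma tens_ind (P : tens -> Prop) :
  P 0 -> (forall c v t, P t -> P (c *: tpure v + t)) -> forall t, P t.
Proof.
move=> P0 PD t; have [g ->] := tpi_surj t; rewrite (monalgE g).
elim: (msupp g : seq _) => [|v s IH]; first by rewrite big_nil raddf0.
rewrite big_cons raddfD /= -[g@_v]mulr1 -scale_malgU linearZ.
exact: PD.
Qed.

Section Lift.
Variables (W : lmodType K) (f : (forall i, V i) -> W).

Definition flift (g : F) : W := \sum_(v <- msupp g) g@_v *: f v.

Lemma fliftw (D : {fset forall i, V i}) g : (msupp g `<=` D)%fset ->
  flift g = \sum_(v <- D) g@_v *: f v.
Proof.
move=> gD; rewrite /flift (big_fset_incl _ gD) //= => v _ /mcoeff_outdom ->.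
by rewrite scale0r.
Qed.

Lemma flift_linear : linear flift.
Proof.
move=> c g h; pose D := (msupp g `|` msupp h)%fset.
rewrite (@fliftw D); last first.
  apply: fsubset_trans (msuppD_le _ _) _.
  by rewrite fsetUSS ?fsubset_refl ?msuppZ_le.
rewrite (@fliftw D g) ?fsubsetUl // (@fliftw D h) ?fsubsetUr //.
rewrite scaler_sumr -big_split /=; apply: eq_bigr => v _.
by rewrite mcoeffD mcoeffZ scalerDl scalerA.
Qed.
HB.instance Definition _ := GRing.isLinear.Build K F W *:%R flift flift_linear.

Lemma fliftU v : flift << v >> = f v.
Proof.
by rewrite (fliftw msuppU_le) big_seq_fset1 mcoeffUU scale1r.
Qed.

Hypothesis fL : multilinear f.

Definition tlift of multilinear f := fun t : tens =>
  flift (repr (t : Quotient.quot tnull_pred)).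

Lemma flift_null g : tnull g -> flift g = 0.
Proof.
elim=> [v i c x y||c h h' _ IH _ IH']; last 1 first.
- by rewrite linearP /= IH IH' scaler0 addr0.
- by rewrite raddfB raddfD /= linearZ /= !fliftU fL subrr.
- by rewrite raddf0.
Qed.

Lemma tlift_pi g : tlift fL (tpi g) = flift g.
Proof.
apply/eqP; rewrite -subr_eq0 /tlift -raddfB; apply/eqP/flift_null.
by apply/tpi_eq; rewrite /tpi reprK.
Qed.

Lemma tlift_pure v : tlift fL (tpure v) = f v.
Proof. by rewrite tlift_pi fliftU. Qed.

Lemma tlift_linear : linear (tlift fL).
Proof.
move=> c t u; have [g ->] := tpi_surj t; have [h ->] := tpi_surj u.
by rewrite -linearZ -raddfD !tlift_pi flift_linear.
Qed.
End Lift.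

Lemma tens_ext (W : lmodType K) (f g : tens -> W) : linear f -> linear g ->
  (forall v, f (tpure v) = g (tpure v)) -> f =1 g.
Proof.
move=> fl gl fg; elim/tens_ind => [|c v t IH]; first by rewrite !lin0.
by rewrite fl gl fg IH.
Qed.

End Tensor.

Arguments multilinear {K I V W}.
Arguments tpure {K I V}.

Section TensorMaps.
Variables (K : fieldType) (I : eqType).

Lemma dfwith_map (V W : I -> Type) (f : forall i, V i -> W i)
    (v : forall i, V i) i (x : V i) :
  (fun j => f j (dfwith v x j)) = dfwith (fun j => f j (v j)) (f i x).
Proof.
apply: functional_extensionality_dep => j.
by case: dfwithP => [|k ik]; rewrite ?dfwith_in ?dfwith_out.
Qed.

Lemma dfwith_map2 (U V W : I -> Type) (f : forall i, U i -> V i -> W i)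
    (v : forall i, U i) i (x : U i) (w : forall i, V i) :
  (fun j => f j (dfwith v x j) (w j)) =
  dfwith (fun j => f j (v j) (w j)) (f i x (w i)).
Proof. exact: (dfwith_map (fun j y => f j y (w j))). Qed.

Section Map.
Variables (V W : I -> lmodType K) (f : forall i, V i -> W i).
Hypothesis fL : forall i, linear (@f i).

Lemma tmap_subproof :
  multilinear (fun v : forall i, V i => tpure (fun i => f (v i))).
Proof. by move=> v i c x y; rewrite !dfwith_map fL tpure_multilinear. Qed.

Definition tmap : tens V -> tens W := tlift tmap_subproof.

Lemma tmap_pure v : tmap (tpure v) = tpure (fun i => f (v i)).
Proof. exact: tlift_pure. Qed.
Lemma tmap_linear : linear tmap. Proof. exact: tlift_linear. Qed.
End Map.

Section Map2.
Variables (U V W : I -> lmodType K) (f : forall i, U i -> V i -> W i).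
Hypothesis fl : forall i y, linear ((@f i)^~ y).
Hypothesis fr : forall i x, linear (@f i x).

Lemma tmap2_subproof1 (u : forall i, U i) :
  multilinear (fun v : forall i, V i => tpure (fun i => f (u i) (v i))).
Proof.
by move=> v i c x y; rewrite !(dfwith_map (fun i => @f i (u i))) fr tpure_multilinear.
Qed.

Lemma tmap2_subproof2 :
  multilinear (fun u => tlift (tmap2_subproof1 u) : tens V -> tens W).
Proof.
move=> u i c x y; apply: funext; apply: tens_ext; first exact: tlift_linear.
  by apply: comb_linear; exact: tlift_linear.
move=> v; rewrite addrfctE scalrfctE !tlift_pure.
by rewrite !dfwith_map2 fl tpure_multilinear.
Qed.

Definition tmap2 : tens U -> tens V -> tens W := tlift tmap2_subproof2.

Lemma tmap2_pure u v :
  tmap2 (tpure u) (tpure v) = tpure (fun i => f (u i) (v i)).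
Proof. by rewrite /tmap2 !tlift_pure. Qed.

Lemma tmap2_linl t : linear (tmap2^~ t).
Proof.
by move=> c u v; rewrite /tmap2 tlift_linear addrfctE scalrfctE.
Qed.

Lemma tmap2_linr t : linear (tmap2 t).
Proof.
elim/tens_ind: t => [|b v t IH].
  have tmap20 z : tmap2 0 z = 0 by exact: (lin0 (tmap2_linl z)).
  by move=> c x y; rewrite 3!tmap20 scaler0 addr0.
have tmap2E : tmap2 (b *: tpure v + t) =
    fun z => b *: tlift (tmap2_subproof1 v) z + tmap2 t z.
  by apply: funext => z; rewrite tmap2_linl /tmap2 tlift_pure.
by rewrite tmap2E; apply: comb_linear => //; exact: tlift_linear.
Qed.
End Map2.
End TensorMaps.

Section Segre.
Variables (K : fieldType) (I : finType).

Section Alg.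
Variable A : I -> zgalg K.

Definition segre_mul i j k (e : i + j = k) :=
  tmap2 (fun s => @zmul_linl K (A s) i j k e) (fun s => @zmul_linr K (A s) i j k e).
Definition segre_one : tens (fun s => A s 0) := tpure (fun s => zone (A s)).

Lemma segre_linr i j k (e : i + j = k) x : linear (segre_mul e x).
Proof. exact: tmap2_linr. Qed.
Lemma segre_linl i j k (e : i + j = k) y : linear ((segre_mul e)^~ y).
Proof. exact: tmap2_linl. Qed.

Lemma segre_mulC i j k (e : i + j = k) (e' : j + i = k) x y :
  segre_mul e x y = segre_mul e' y x.
Proof.
move: x; apply: tens_ext; [exact: segre_linl|exact: segre_linr|move=> u].
move: y; apply: tens_ext; [exact: segre_linr|exact: segre_linl|move=> v].
rewrite /segre_mul !tmap2_pure; congr tpure.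
by apply: functional_extensionality_dep => s; exact: zmulC.
Qed.
End Alg.

Section Act.
Variables (A : I -> zgalg K) (M : forall s, zgmod (A s)).

Definition segre_act i j k (e : i + j = k) :=
  tmap2 (fun s => @zact_linl K (A s) (M s) i j k e)
        (fun s => @zact_linr K (A s) (M s) i j k e).

Lemma segre_act_linr i j k (e : i + j = k) x : linear (segre_act e x).
Proof. exact: tmap2_linr. Qed.
Lemma segre_act_linl i j k (e : i + j = k) y : linear ((segre_act e)^~ y).
Proof. exact: tmap2_linl. Qed.
Lemma segre_act_pure i j k (e : i + j = k) x y :
  segre_act e (tpure x) (tpure y) = tpure (fun s => zact e (x s) (y s)).
Proof. exact: tmap2_pure. Qed.

Lemma segre_actA i j k ij jk ijk (e1 : i + j = ij) (e2 : ij + k = ijk)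
    (e3 : j + k = jk) (e4 : i + jk = ijk) x y z :
  segre_act e2 (segre_mul e1 x y) z = segre_act e4 x (segre_act e3 y z).
Proof.
move: x; apply: tens_ext.
- exact: (comp_linear (segre_act_linl e2 z) (segre_linl e1 y)).
- exact: segre_act_linl.
move=> u; move: y; apply: tens_ext.
- exact: (comp_linear (segre_act_linl e2 z) (segre_linr e1 _)).
- exact: (comp_linear (segre_act_linr e4 _) (segre_act_linl e3 z)).
move=> v; move: z; apply: tens_ext.
- exact: segre_act_linr.
- exact: (comp_linear (segre_act_linr e4 _) (segre_act_linr e3 _)).
move=> w; rewrite /segre_mul /segre_act !tmap2_pure; congr tpure.
by apply: functional_extensionality_dep => s; exact: zactA.
Qed.

Lemma segre_act1 j (e : 0 + j = j) x : segre_act e (segre_one A) x = x.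
Proof.
move: x; apply: tens_ext; [exact: segre_act_linr|by []|move=> v].
rewrite segre_act_pure; congr tpure.
by apply: functional_extensionality_dep => s; exact: zact1.
Qed.
End Act.

(* The component of degree j is the tensor product of the components of degree
   j. For N-graded factors the components of negative degree are zero, provided
   that the family is not empty. *)
Definition segre_alg (A : I -> zgalg K) : zgalg K :=
  @ZGAlg K (fun j => tens (fun s => A s j)) (@segre_mul A) (segre_one A)
    (@segre_linr A) (@segre_mulC A)
    (@segre_actA A (fun s => regular (A s)))
    (@segre_act1 A (fun s => regular (A s))).

Definition segre (A : I -> zgalg K) (M : forall s, zgmod (A s)) :
    zgmod (segre_alg A) :=
  @ZGMod K (segre_alg A) (fun j => tens (fun s => M s j)) (@segre_act A M)
    (@segre_act_linl A M) (@segre_act_linr A M)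
    (@segre_actA A M) (@segre_act1 A M).

Section NaturalMap.
Variables (A : I -> zgalg K) (M : forall s, zgmod (A s)) (j : int).

Definition natmap_pure (phi : forall s, dual (M s) j) : dual (segre M) j.
Proof.
refine (@ZHom K (segre_alg A) (segre M) (regular (segre_alg A)) j
  (fun k => tmap (fun s => @zhom_lin _ _ _ _ _ (phi s) k)) _ _).
- by move=> k; exact: tmap_linear.
- move=> i k l e e' x y; move: x; apply: tens_ext.
  + exact: (comp_linear (tmap_linear _) (segre_act_linl (M := M) e y)).
  + exact: (segre_linl (A := A) e').
  move=> u; move: y; apply: tens_ext.
  + exact: (comp_linear (tmap_linear _) (segre_act_linr (M := M) e _)).
  + exact: (comp_linear (segre_linr (A := A) e' _) (tmap_linear _)).
  move=> v /=; rewrite segre_act_pure !tmap_pure /segre_mul tmap2_pure.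
  congr tpure; apply: functional_extensionality_dep => s.
  exact: (zhom_act (phi s) e e').
Defined.

Lemma natmap_subproof : multilinear natmap_pure.
Proof.
move=> phi s c f g; apply: zhomP => k; apply: tens_ext.
- exact: (zhom_lin (natmap_pure _)).
- exact: (zhom_lin (_ *: natmap_pure _ + natmap_pure _)).
move=> v; rewrite zhomDE zhomZE /= !tmap_pure.
rewrite !(dfwith_map2 (fun s (h : dual (M s) j) (x : M s k) => h k x) phi _ v).
by rewrite zhomDE zhomZE tpure_multilinear.
Qed.

(* The component of degree j of the natural map alpha. *)
Definition natmap : segre (fun s => dual (M s)) j -> dual (segre M) j :=
  tlift natmap_subproof.

Lemma natmapE (phi : forall s, dual (M s) j) k (x : forall s, M s k) :
  natmap (tpure phi) k (tpure x) = tpure (fun s => phi s k (x s)).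
Proof. by rewrite /natmap tlift_pure /= tmap_pure. Qed.

Lemma natmap_linear : linear natmap.
Proof. exact: tlift_linear. Qed.
End NaturalMap.

(* alpha is linear over the Segre product algebra. *)
Lemma natmap_act (A : I -> zgalg K) (M : forall s, zgmod (A s))
    i j l (e : i + j = l) (r : segre_alg A i)
    (t : segre (fun s => dual (M s)) j) :
  natmap (zact e r t) = zact e r (natmap t).
Proof.
move: r; apply: tens_ext.
- exact: (comp_linear (@natmap_linear A M l)
           (@zact_linl K _ (segre (fun s => dual (M s))) _ _ _ e t)).
- exact: (@zact_linl K _ (dual (segre M))).
move=> r; move: t; apply: tens_ext.
- exact: (comp_linear (@natmap_linear A M l)
           (@zact_linr K _ (segre (fun s => dual (M s))) _ _ _ e _)).
- exact: (comp_linear (@zact_linr K _ (dual (segre M)) _ _ _ e _)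
           (@natmap_linear A M j)).
move=> phi; apply: zhomP => k; apply: tens_ext.
- exact: (@zhom_lin _ _ _ _ _ (natmap _)).
- exact: (@zhom_lin _ _ _ _ _ (@zact _ _ (dual (segre M)) _ _ _ e _ (natmap _))).
move=> x; transitivity (natmap (tpure (fun s => zact e (r s) (phi s))) k (tpure x)).
  exact: (congr1 (fun t => zhom_fun (natmap t) (tpure x))
    (@segre_act_pure A (fun s => dual (M s)) i j l e r phi)).
transitivity (segre_mul (A := A) (dual_eq k e) (tpure r)
                (natmap (tpure phi) k (tpure x))); last by [].
by rewrite !natmapE /segre_mul tmap2_pure.
Qed.

(* A homogeneous linear map is an isomorphism iff it is bijective in each
   degree. *)
Definition friendly (R : I -> gradedAlg K) : Prop :=
  forall (a : I -> int) (j : int),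
    bijective (@natmap (fun s => zgalg_of (R s))
      (fun s => shift (regular (zgalg_of (R s))) (a s)) j).

End Segre.

(* Main.v *)
Require Import Defs.
From mathcomp Require Import all_boot all_order all_algebra.
From mathcomp Require Import finmap monalg.
From mathcomp Require Import boolp.
From mathcomp Require Import zify.

Set Implicit Arguments.
Unset Strict Implicit.
Unset Printing Implicit Defensive.

Import Order.TTheory GRing.Theory Num.Theory.
Local Open Scope ring_scope.

(** Embed each R_i in a Laurent polynomial ring, so that R_i has a basis of
    monomials t^b, and write S_i,n for the set of exponents of the monomials of
    degree n ([has_monomial]). Since Hom(R_i, R_i) = R_i, the dual of R_i(a_i)
    in degree j is the component of R_i of degree j - a_i, acting by
    multiplication ([dual_shiftE], [mul_hom]). A tensor product of spaces with
    monomial bases has the products of these bases as a basis; here this is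
    expressed by coefficient functionals [coef], indexed by the families of
    exponents, which separate tensors ([coef_ext]).

    In these terms a T-linear map phi : R_1(a_1) # ... # R_m(a_m) -> T is
    multiplication by a fixed Laurent polynomial: for monomial tensors x and z,
    the images phi(x) and phi(z) have the same coefficients up to translation by
    the exponents of x and z ([dual_segre_coef]), because some monomials p, p'
    of T satisfy p x = p' z. Hence an exponent family u that occurs in
    phi(x) / x also occurs in phi(z) / z for every monomial tensor z, which says
    that u_i + S_i,n is contained in S_i,n+delta for all large n, with
    delta = j - a_i. This is where the depth enters: for a regular sequence
    r, s in the maximal ideal of R_i, the products r^k s^l t^u_i lie in R_i as soon as
    k + l is large, and descending induction on k + l brings this down to
    t^u_i itself ([depth2_saturated]). So each u_i is a monomial of R_i of
    degree j - a_i ([monomial_quotient]), which represents an element of the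
    dual of R_i(a_i), and the sum of the resulting pure tensors of duals is a
    preimage of phi ([natmap_surjective]). Injectivity is read off from the
    coefficients of the image of a single monomial tensor
    ([natmap_injective]). *)

(** * Monomials in the Laurent polynomial ring *)

Section LaurentMonomials.
Variables (K : fieldType) (d : nat).
Implicit Types (a b : 'cV[int]_d) (g h : laurent K d).

Lemma laurentE g : g = \sum_(a <- msupp g) g@_a *: lmon K a.
Proof.
rewrite [LHS]monalgE; apply: eq_bigr => a _.
by rewrite [RHS]scale_malgU mulr1.
Qed.

Lemma mcoeff_lmon a b : (lmon K a)@_b = (a == b)%:R.
Proof. exact: mcoeffU. Qed.

Lemma mem_msupp_lmon a b : (b \in msupp (lmon K a)) = (b == a).
Proof. by rewrite msuppU oner_eq0 inE. Qed.

Lemma lmonM_inj a : injective (fun g => lmon K a * g).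
Proof.
move=> g h /(congr1 (fun x => lmon K (- a) * x)).
by rewrite !mulrA -lmonD addNr lmon0 !mul1r.
Qed.

Lemma lmon_neq0 a : lmon K a != 0.
Proof. by rewrite monalgU_eq0 oner_eq0. Qed.

Lemma mcoeff_lmonM a g b : (lmon K a * g)@_(a + b) = g@_b.
Proof.
elim/malg_ind: g => [|c a' g IH]; first by rewrite mulr0 !mcoeff0.
rewrite mulrDr !mcoeffD IH; congr (_ + _).
by rewrite [_ * _]lmulUU mul1r !mcoeffU (inj_eq (addrI a)).
Qed.

Lemma msupp_laurentM g h c : c \in msupp (g * h) ->
  exists a b, [/\ a \in msupp g, b \in msupp h & c = a + b].
Proof.
move=> cgh; apply: contrapT => no; move: cgh; apply/negP.
rewrite -mcoeff_eq0 [g * h](lmulw (fsubset_refl _) (fsubset_refl _)).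
rewrite raddf_sum /= big_seq big1 // => a ag.
rewrite raddf_sum /= big_seq big1 // => b bh.
rewrite mcoeffU; case: eqP => // E; case: no; by exists a, b.
Qed.

End LaurentMonomials.

(** * Monomials of an embedded graded algebra *)

Lemma hcompN (K : fieldType) (R : gradedAlg K) n (x : R) :
  x \in hcomp R n -> - x \in hcomp R n.
Proof. by move=> xn; rewrite -scaleN1r rpredZ. Qed.

Section ToricMonomials.
Variables (K : fieldType) (R : gradedAlg K) (d : nat).
Variable f : {lrmorphism R -> laurent K d}.
Implicit Types (a b u : 'cV[int]_d) (x y : R) (n p : int).

Definition has_monomial n a := exists2 x : R, x \in hcomp R n & f x = lmon K a.

Lemma has_monomialD n p a b :
  has_monomial n a -> has_monomial p b -> has_monomial (n + p) (a + b).
Proof.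
move=> [x xn fx] [y yp fy]; exists (x * y); first exact: hcompM.
by rewrite rmorphM /= fx fy lmonD.
Qed.

Hypothesis f_inj : injective f.

(** A nonzero element cannot lie in two components, as their sum is direct; so
    an exponent determines the degree of its monomial. *)
Lemma has_monomial_deg n p a : has_monomial n a -> has_monomial p a -> n = p.
Proof.
move=> [x xn fx] [y yp fy]; have xy : x = y by apply: f_inj; rewrite fx fy.
subst y; apply/eqP/negPn/negP => np.
pose c j : R := if j == n then x else if j == p then - x else 0.
have cP j : c j \in hcomp R j.
  rewrite /c; case: eqP => [->//|_]; case: eqP => [->|_]; last exact: rpred0.
  exact: hcompN.
have := @hcomp_direct _ R [:: n; p] c _ cP _ n.
rewrite !big_cons big_nil /c eqxx eq_sym (negPf np) eqxx addr0 subrr inE eqxx.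
rewrite /= inE (negPf np) => /(_ erefl erefl erefl) x0.
by have := lmon_neq0 K a; rewrite -fx x0 raddf0 eqxx.
Qed.

Hypothesis f_supp : forall x a, a \in msupp (f x) ->
  exists2 n, 0 <= n & has_monomial n a.

Lemma supported_image (g : laurent K d) :
  (forall a, a \in msupp g -> exists n, has_monomial n a) ->
  exists x, f x = g.
Proof.
move=> gS; rewrite (laurentE g).
suff: forall s : seq 'cV[int]_d, {subset s <= msupp g} ->
    exists x, f x = \sum_(a <- s) g@_a *: lmon K a by apply.
elim=> [|a s IH] sub; first by exists 0; rewrite big_nil raddf0.
have [|x fx] := IH; first by move=> b bs; apply: sub; rewrite inE bs orbT.
have [n [y _ fy]] := gS a (sub a (mem_head _ _)).
by exists (g@_a *: y + x); rewrite big_cons linearP /= fx fy.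
Qed.

(** A homogeneous element involves only monomials of its own degree. Grouping its
    monomials by degree and subtracting the element from the group of degree n
    gives a vanishing sum of homogeneous terms, so that every group of another
    degree vanishes. *)
Lemma homogeneous_supp n x a :
  x \in hcomp R n -> a \in msupp (f x) -> has_monomial n a.
Proof.
move=> xn ax.
have degP b : exists p, b \in msupp (f x) -> has_monomial p b.
  case: (boolP (b \in msupp (f x))) => [/f_supp[p _ bp]|]; first by exists p.
  by exists 0.
have /choice[deg {}degP] := degP.
have monP b : exists y : R, b \in msupp (f x) -> y \in hcomp R (deg b) /\ f y = lmon K b.
  case: (boolP (b \in msupp (f x))) => [/degP[y yd fy]|]; first by exists y.
  by exists 0.
have /choice[e eP] := monP.
have xE : x = \sum_(b <- msupp (f x)) (f x)@_b *: e b.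
  apply: f_inj; rewrite [LHS]laurentE linear_sum; apply: eq_big_seq => b bx.
  by rewrite linearZ /= (eP b bx).2.
suff -> : n = deg a by apply: degP.
apply/eqP/negPn/negP => na.
(* The element c p is the degree p part of the monomial expansion of x, minus the
   degree p part of x itself. *)
pose c p := \sum_(b <- msupp (f x) | deg b == p) (f x)@_b *: e b
   - (if p == n then x else 0).
have cP p : c p \in hcomp R p.
  apply: rpredD; last first.
    by apply: hcompN; case: eqP => [->|_] //; exact: rpred0.
  rewrite big_seq_cond; apply: rpred_sum => b /andP[bx /eqP <-].
  by rewrite rpredZ // (eP b bx).1.
pose s := undup (n :: [seq deg b | b <- msupp (f x)]).
have us : uniq s := undup_uniq _.
have ins b : b \in msupp (f x) -> deg b \in s.
  by move=> bx; rewrite mem_undup inE map_f ?orbT.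
have s0 : \sum_(p <- s) c p = 0.
  rewrite big_split sumrN /=; apply/eqP; rewrite subr_eq0; apply/eqP.
  rewrite [RHS](bigD1_seq n) ?mem_undup ?mem_head //= eqxx.
  rewrite [X in _ = _ + X]big1 ?addr0; last by move=> p /negPf ->.
  rewrite [RHS]xE (exchange_big_dep predT) //=; apply: eq_big_seq => b bx.
  rewrite big_mkcond (bigD1_seq (deg b)) ?ins //= ?eqxx //.
  by rewrite big1 ?addr0 // => p; rewrite eq_sym => /negPf ->.
have := hcomp_direct us cP s0 (ins a ax).
rewrite /c (negPf (_ : deg a != n)) 1?eq_sym // subr0.
move=> /(congr1 f); rewrite raddf0 => /(congr1 (fun g : laurent K d => g@_a)).
rewrite linear_sum raddf_sum mcoeff0 -big_filter.
rewrite (bigD1_seq a) ?filter_uniq ?mem_filter ?eqxx ?fset_uniq //=.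
rewrite big_seq_cond big1 => [|b]; last first.
  rewrite mem_filter => /andP[/andP[_ bx] ba].
  rewrite linearZ /= (eP b bx).2 mcoeffZ mcoeff_lmon (negPf ba) mulr0 //.
rewrite addr0 linearZ /= (eP a ax).2 mcoeffZ mcoeff_lmon eqxx mulr1.
by move/eqP; rewrite mcoeff_eq0 ax.
Qed.

End ToricMonomials.
(** * Depth two and saturation *)

(** The Laurent polynomials whose support satisfies the conclusion form a
    subalgebra that contains the generators. The last clause records that the
    algebra has a generator unless it is reduced to constants. *)
Lemma toric_supp (K : fieldType) (R : gradedAlg K) (d n : nat)
    (a : 'M[int]_(d, n)) (f : {lrmorphism R -> laurent K d}) :
  (forall y, (exists x, f x = y) ->
     in_subalg [seq lmon K (col i a) | i <- enum 'I_n] y) ->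
  (forall i, exists2 x : R, x \in hcomp R 1 & f x = lmon K (col i a)) ->
  forall x b, b \in msupp (f x) -> exists p : int,
    [/\ 0 <= p, has_monomial f p b & p != 0 -> exists c, has_monomial f 1 c].
Proof.
move=> fim gen x b.
pose good (b : 'cV[int]_d) := exists p : int,
  [/\ 0 <= p, has_monomial f p b & p != 0 -> exists c, has_monomial f 1 c].
pose S : {pred laurent K d} :=
  [pred g | `[< forall b, b \in msupp g -> good b >]].
suff /asboolP/(_ b) : f x \in S by [].
have fx_im : exists x', f x' = f x by exists x.
apply: (fim _ fx_im) => [|_ /mapP[i _ ->]]; last first.
  apply/asboolP => c; rewrite mem_msupp_lmon => /eqP ->.
  by exists 1; split=> // _; exists (col i a).
split.
- apply/asboolP => c; rewrite -(lmon0 K d) mem_msupp_lmon => /eqP ->.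
  exists 0; split=> //; exists 1; [exact: hcomp1|by rewrite rmorph1].
- move=> k g h /asboolP gS /asboolP hS; apply/asboolP => c.
  move/(fsubsetP (msuppD_le _ _)); rewrite in_fsetU.
  by case/orP => [/(fsubsetP (msuppZ_le _ _))|]; [exact: gS|exact: hS].
- move=> g h /asboolP gS /asboolP hS; apply/asboolP => c.
  case/msupp_laurentM => [c1 [c2 [/gS[p [p0 pc p1]] /hS[q [q0 qc q1]] ->]]].
  exists (p + q); split; [exact: addr_ge0|exact: has_monomialD|].
  case: (eqVneq p 0) => [->|/p1 //]; rewrite add0r; exact: q1.
Qed.

Section Saturation.
Variables (K : fieldType) (R : gradedAlg K) (d : nat).
Variable f : {lrmorphism R -> laurent K d}.
Hypothesis f_inj : injective f.
Hypothesis f_supp : forall x a, a \in msupp (f x) ->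
  exists2 n, 0 <= n & has_monomial f n a.

Definition supported_from (N : int) (g : laurent K d) :=
  forall a, a \in msupp g -> exists2 n, N <= n & has_monomial f n a.

Lemma supported_fromM N M g h : supported_from N g -> supported_from M h ->
  supported_from (N + M) (g * h).
Proof.
move=> gN hM _ /msupp_laurentM[a [b [/gN[n Nn na] /hM[p Mp pb] ->]]].
by exists (n + p); [exact: lerD|exact: has_monomialD].
Qed.

Lemma supported_fromX (N : nat) g :
  supported_from 1 g -> supported_from N%:Z (g ^+ N).
Proof.
move=> g1; elim: N => [|N IH].
  move=> a; rewrite expr0 -(lmon0 K d) mem_msupp_lmon => /eqP ->.
  by exists 0 => //; exists 1; [exact: hcomp1|rewrite rmorph1].
by rewrite exprS -add1n PoszD; apply: supported_fromM.
Qed.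

Lemma maxideal_supported x : in_maxideal x -> supported_from 1 (f x).
Proof.
move=> [s [c [s_gt0 cP ->]]] a; rewrite linear_sum /= => ac.
have [j js aj] : exists2 j, j \in s & a \in msupp (f (c j)).
  apply: contrapT => no; move: ac; rewrite -mcoeff_neq0 raddf_sum /=.
  rewrite big_seq big1 ?eqxx // => j js; apply: mcoeff_outdom.
  by apply/negP => aj; apply: no; exists j.
by exists j; [exact: s_gt0|exact: (homogeneous_supp f_inj f_supp (cP j) aj)].
Qed.

Lemma has_monomial_all n :
  (exists b, has_monomial f 1 b) -> 0 <= n -> exists b, has_monomial f n b.
Proof.
case: n => // n [b b1] _; exists (b *+ n).
elim: n => [|n IH]; first by exists 1; [exact: hcomp1|rewrite rmorph1 mulr0n].
by rewrite mulrS -add1n PoszD; apply: has_monomialD.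
Qed.

Hypothesis depth2 : depth_ge R 2.

Lemma depth_regular_pair : exists x y : R,
  [/\ in_maxideal x, in_maxideal y,
      forall z, x * z = 0 -> z = 0
    & forall z w, y * z = x * w -> exists w', z = x * w'].
Proof.
case: depth2 => -[|x [|y s]] [] // _ sm [reg _]; exists x, y; split.
- by apply: sm; rewrite inE eqxx.
- by apply: sm; rewrite !inE eqxx orbT.
- move=> z xz; have [|c ->] := reg 0%N isT z.
    by exists (fun=> 0); rewrite big_ord0 xz.
  by rewrite big_ord0.
- move=> z w yz; have [|c ->] := reg 1%N isT z.
    by exists (fun=> w); rewrite /= big_ord1 /= yz mulrC.
  by exists (c ord0); rewrite /= big_ord1 mulrC.
Qed.

(** Positive depth excludes the algebra K, which is the only toric ring without a
    monomial of degree one: a regular element of the maximal ideal is nonzero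
    and so involves a monomial of positive degree. *)
Lemma depth_has_monomial1 :
  (forall x b, b \in msupp (f x) -> exists p : int,
    [/\ 0 <= p, has_monomial f p b & p != 0 -> exists c, has_monomial f 1 c]) ->
  exists c, has_monomial f 1 c.
Proof.
move=> supp1; have [x [_ [xm _ x_reg _]]] := depth_regular_pair.
have /fset0Pn[b bx] : msupp (f x) != fset0.
  apply/eqP => fx0; have {}fx0 : f x = 0.
    by rewrite [LHS]laurentE fx0 big_seq_fset0.
  have x0 : x = 0 by apply: f_inj; rewrite fx0 raddf0.
  have := x_reg 1; rewrite x0 mul0r => /(_ erefl)/eqP.
  by rewrite oner_eq0.
have [n n1 bn] := maxideal_supported xm bx.
have [p [_ bp]] := supp1 x b bx; apply.
rewrite (has_monomial_deg f_inj bp bn); lia.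
Qed.

Hypothesis mon1 : exists b, has_monomial f 1 b.

(** In terms of local cohomology, t^u defines an element of Hom(m^n0, R) for the
    maximal ideal m, and depth two makes R -> Hom(m^n0, R) surjective: if
    x v = p and y v = q lie in R for a regular sequence x, y, then y p = x q,
    hence p = x r for some r in R, and v = r. This is applied to
    v = x^k y^l t^u by descending induction on k + l. *)
Lemma depth2_saturated (n0 : int) (u : 'cV[int]_d) (delta : int) :
  (forall n z, n0 <= n -> has_monomial f n z ->
     has_monomial f (n + delta) (u + z)) ->
  has_monomial f delta u.
Proof.
move=> u_mul; have [x [y [xm ym x_reg xy_reg]]] := depth_regular_pair.
pose im g := exists r, f r = g.
have big_im (N : nat) g : n0 <= N%:Z -> supported_from N%:Z g -> im (g * lmon K u).
  move=> N0 gN; apply: supported_image => c /msupp_laurentM[a [b []]].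
  move=> /gN[n Nn na]; rewrite mem_msupp_lmon => /eqP -> ->.
  exists (n + delta); rewrite [a + u]addrC; apply: u_mul na => //.
  exact: le_trans N0 Nn.
have [z [n [zn n0n]]] : exists z n, has_monomial f n z /\ n0 <= n.
  have [|z zn] := @has_monomial_all `|n0| mon1; first by [].
  by exists z, `|n0|; split=> //; exact: ler_norm.
(* The regularity of x is known only inside R; multiplication by t^z carries v
   there, and t^z is invertible among Laurent polynomials. *)
have x_reg_u v : im (lmon K z * v) -> f x * v = 0 -> v = 0.
  move=> [r fr] xv0; apply: (@lmonM_inj _ _ z); rewrite mulr0 -fr.
  rewrite (x_reg r) ?raddf0 //; apply: f_inj; rewrite raddf0 rmorphM /= fr.
  by rewrite mulrCA xv0 mulr0.
have step g : im g -> im (f x * (g * lmon K u)) -> im (f y * (g * lmon K u)) ->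
    im (g * lmon K u).
  move=> [s gs] [p fp] [q fq]; have [|r pr] := xy_reg p q.
    by apply: f_inj; rewrite !rmorphM /= fp fq mulrCA.
  exists r; apply/eqP; rewrite eq_sym -subr_eq0; apply/eqP/x_reg_u.
    have [t _ ft] := u_mul n z n0n zn; have [z' _ fz'] := zn.
    exists (s * t - z' * r); rewrite raddfB /= !rmorphM /= gs ft fz' mulrBr.
    by rewrite lmonD [lmon K z * (g * _)]mulrC mulrA.
  by rewrite mulrBr -fp pr rmorphM subrr.
(* The induction is on s, which measures how far i + j is below the bound. *)
have main s : forall i j : nat, (`|n0| <= i + j + s)%N ->
    im (f x ^+ i * f y ^+ j * lmon K u).
  elim: s => [|s IH] i j le.
    apply: (big_im (i + j)%N); first lia.
    by rewrite PoszD; apply: supported_fromM; apply: supported_fromX;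
       exact: maxideal_supported.
  apply: step.
  - by exists (x ^+ i * y ^+ j); rewrite rmorphM !rmorphXn.
  - by rewrite !mulrA -exprS; apply: IH; lia.
  - rewrite [f y * _]mulrA [f y * _]mulrCA -exprS; apply: IH; lia.
have [r fr] := main `|n0|%N 0%N 0%N (leqnn _).
rewrite !expr0 !mul1r in fr.
have [p _ up] : exists2 p, 0 <= p & has_monomial f p u.
  by apply: (f_supp (x := r)); rewrite fr mem_msupp_lmon.
suff -> : delta = p by [].
have E := has_monomial_deg f_inj (u_mul n z n0n zn) (has_monomialD up zn).
by move: E; rewrite [_ + delta]addrC => /addIr.
Qed.

End Saturation.
(** What the computation of the duals needs to know about a toric ring of depth
    at least two; the last clause is the vanishing of the first local
    cohomology, restricted to monomials. *)
Definition saturated_embedding (K : fieldType) (R : gradedAlg K) (d : nat)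
    (f : {lrmorphism R -> laurent K d}) : Prop :=
  [/\ injective f,
      forall n x a, x \in hcomp R n -> a \in msupp (f x) -> has_monomial f n a,
      forall n, 0 <= n -> exists b, has_monomial f n b
    & forall (n0 : int) (u : 'cV[int]_d) (delta : int),
        (forall n z, n0 <= n -> has_monomial f n z ->
           has_monomial f (n + delta) (u + z)) ->
        has_monomial f delta u].

Lemma toric_depth2_saturated (K : fieldType) (R : gradedAlg K) :
  toric R -> depth_ge R 2 ->
  exists (d : nat) (f : {lrmorphism R -> laurent K d}), saturated_embedding f.
Proof.
move=> [d [n [a [f [f_inj fim gen]]]]] depth2; exists d, f.
have supp1 := toric_supp (fun y => (fim y).1) gen.
have f_supp x b : b \in msupp (f x) -> exists2 p, 0 <= p & has_monomial f p b.
  by case/supp1 => p [p0 pb _]; exists p.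
have mon1 := depth_has_monomial1 f_inj f_supp depth2 supp1.
split=> //; first exact: homogeneous_supp.
- by move=> p; apply: has_monomial_all.
- by move=> n0 u delta; apply: depth2_saturated.
Qed.

(** * Coefficients of tensors *)

Lemma linear_comb (K : fieldType) (U W : lmodType K) (F : U -> W) :
  linear F -> forall (T : Type) (s : seq T) (c : T -> K) (u : T -> U),
  F (\sum_(x <- s) c x *: u x) = \sum_(x <- s) c x *: F (u x).
Proof.
move=> FL T s c u; elim: s => [|x s IH]; first by rewrite !big_nil (lin0 FL).
by rewrite !big_cons FL IH.
Qed.

Section TensorCoefficients.
Variables (K : fieldType) (I : finType) (V : I -> lmodType K) (d : I -> nat).
(* The maps g i realize the V i as spaces of Laurent polynomials; below they are
   injective, with images spanned by monomials. *)
Variable g : forall i, V i -> laurent K (d i).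
Hypothesis gL : forall i, linear (@g i).
Implicit Types (al : forall i, 'cV[int]_(d i)) (v : forall i, V i).

Definition pure_coef al v : K^o := \prod_i (g (v i))@_(al i).

Lemma pure_coef_multilinear al : multilinear (pure_coef al).
Proof.
move=> v i c x y; rewrite /pure_coef.
have E z : \prod_k (g (dfwith v z k))@_(al k) =
    (g z)@_(al i) * \prod_(k | k != i) (g (v k))@_(al k).
  rewrite (bigD1 i) //= dfwith_in; congr (_ * _); apply: eq_bigr => k ki.
  by rewrite dfwith_out // eq_sym.
by rewrite !E gL mcoeffD mcoeffZ mulrDl -mulrA.
Qed.

(** The coefficient of t^al in the image of a tensor in the tensor product of the
    Laurent polynomial rings. *)
Definition coef al : tens V -> K^o := tlift (pure_coef_multilinear al).

Lemma coef_linear al : linear (coef al). Proof. exact: tlift_linear. Qed.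

Lemma coef_pure al v : coef al (tpure v) = \prod_i (g (v i))@_(al i).
Proof. exact: tlift_pure. Qed.

Lemma coef_tpi al (h : {malg K[forall i, V i]}) :
  coef al (tpi h) = \sum_(v <- msupp h) h@_v * \prod_i (g (v i))@_(al i).
Proof. by rewrite /coef tlift_pi. Qed.

Definition monomial_family v := forall i, exists a, g (v i) = lmon K a.

(** The representing element of the free space is itself indexed by monomial
    families: injectivity of the g i then makes distinct families have distinct
    exponents, and no terms need to be collected. *)
Definition monomial_combination (t : tens V) :=
  exists2 h : {malg K[forall i, V i]}, t = tpi h &
    forall v, v \in msupp h -> monomial_family v.

Lemma monomial_combination_comb c t u : monomial_combination t ->
  monomial_combination u -> monomial_combination (c *: t + u).
Proof.
move=> [h -> hP] [k -> kP]; exists (c *: h + k); first by rewrite linearP.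
move=> v /(fsubsetP (msuppD_le _ _)); rewrite in_fsetU.
by case/orP => [/(fsubsetP (msuppZ_le _ _))|]; [exact: hP|exact: kP].
Qed.

Lemma monomial_combination0 : monomial_combination 0.
Proof. by exists 0; [rewrite raddf0|move=> v; rewrite msupp0 inE]. Qed.

Hypothesis g_inj : forall i, injective (@g i).
Hypothesis g_mon : forall i (x : V i) a, a \in msupp (g x) ->
  exists w, g w = lmon K a.

Lemma monomial_expansion i (x : V i) : exists (e : 'cV[int]_(d i) -> V i),
  x = \sum_(a <- msupp (g x)) (g x)@_a *: e a
  /\ forall a, a \in msupp (g x) -> g (e a) = lmon K a.
Proof.
have ex a : exists w, a \in msupp (g x) -> g w = lmon K a.
  case: (boolP (a \in msupp (g x))) => [/g_mon[w gw]|_]; first by exists w.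
  by exists 0.
have /choice[e eP] := ex; exists e; split=> //; apply: g_inj.
rewrite [LHS]laurentE.
rewrite (linear_comb (@gL i)); apply: eq_big_seq => a ax.
by rewrite eP.
Qed.

(** The entries are expanded one after the other by multilinearity: the induction
    is over a sequence s containing the indices whose entries need not be
    monomials yet. *)
Lemma monomial_combination_pure v : monomial_combination (tpure v).
Proof.
suff: forall (s : seq I) v,
    (forall i, i \notin s -> exists a, g (v i) = lmon K a) ->
    monomial_combination (tpure v).
  by move/(_ (enum I) v); apply=> i; rewrite mem_enum.
elim=> [|i s IH] {}v vP.
  exists << v >> => // w; rewrite msuppU oner_eq0 inE => /eqP -> i.
  exact: vP.
have vE : tpure v = tpure (dfwith v (v i)).
  congr tpure; apply: functional_extensionality_dep => j.
  by case: dfwithP.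
have [e [viE eP]] := monomial_expansion (v i).
have dfL : linear (fun x : V i => tpure (dfwith v x)).
  by move=> c x y; exact: tpure_multilinear.
rewrite vE viE.
suff: forall r : seq 'cV[int]_(d i), {subset r <= msupp (g (v i))} ->
    monomial_combination
      (tpure (dfwith v (\sum_(a <- r) (g (v i))@_a *: e a))) by apply.
elim=> [|a r IHr] sub.
  by rewrite big_nil (lin0 dfL); exact: monomial_combination0.
rewrite big_cons dfL; apply: monomial_combination_comb; last first.
  by apply: IHr => b br; apply: sub; rewrite inE br orbT.
apply: IH => j js; case: (eqVneq i j) => [ij|ij].
  subst j; rewrite dfwith_in.
  by exists a; apply: eP; apply: sub; rewrite inE eqxx.
by rewrite dfwith_out //; apply: vP; rewrite inE negb_or eq_sym ij.
Qed.

Lemma tens_monomials t : monomial_combination t.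
Proof.
elim/tens_ind: t => [|c v t IH]; first exact: monomial_combination0.
by apply: monomial_combination_comb => //; exact: monomial_combination_pure.
Qed.

Lemma tens_monomial_ext (W : lmodType K) (F G : tens V -> W) :
  linear F -> linear G ->
  (forall v, monomial_family v -> F (tpure v) = G (tpure v)) -> F =1 G.
Proof.
move=> FL GL FG t; have [h -> hP] := tens_monomials t.
have -> : tpi h = \sum_(v <- msupp h) h@_v *: tpure v.
  rewrite [in LHS](monalgE h) raddf_sum; apply: eq_bigr => v _ /=.
  by rewrite -[h@_v in LHS]mulr1 -scale_malgU linearZ.
rewrite (linear_comb FL) (linear_comb GL); apply: eq_big_seq => v vh.
by rewrite FG //; exact: hP.
Qed.

(** By injectivity of the g i, only the family v itself has the exponents al. *)
Lemma coef_monomials (h : {malg K[forall i, V i]}) al v :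
  (forall w, w \in msupp h -> monomial_family w) ->
  (forall i, g (v i) = lmon K (al i)) -> coef al (tpi h) = h@_v.
Proof.
move=> hP vP; rewrite coef_tpi.
have vv : \prod_i (g (v i))@_(al i) = 1.
  by rewrite big1 // => i _; rewrite vP mcoeff_lmon eqxx.
have wv w : w \in msupp h -> w != v -> h@_w * \prod_i (g (w i))@_(al i) = 0.
  move=> wh wv; have [i] : exists i, w i <> v i.
    apply: contrapT => no; move/eqP: wv; apply.
    apply: functional_extensionality_dep => i; apply: contrapT => wvi.
    by apply: no; exists i.
  move=> wvi; rewrite (bigD1 i) //=; have [a wa] := hP w wh i.
  rewrite wa mcoeff_lmon; case: eqP => [aal|]; last by rewrite mul0r mulr0.
  by case: wvi; apply: g_inj; rewrite wa vP aal.
case: (boolP (v \in msupp h)) => [vh|vh].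
  rewrite (bigD1_seq v) ?fset_uniq //= vv mulr1 big_seq_cond big1 ?addr0 //.
  by move=> w /andP[]; exact: wv.
rewrite (mcoeff_outdom vh) big_seq big1 // => w wh; apply: wv => //.
by apply: contraNneq vh => <-.
Qed.

Lemma coef_ext t u : (forall al, coef al t = coef al u) -> t = u.
Proof.
move=> tu; apply/eqP; rewrite -subr_eq0; apply/eqP.
suff coef0 w : (forall al, coef al w = 0) -> w = 0.
  apply: coef0 => al; rewrite addrC -scaleN1r coef_linear tu.
  by rewrite scaleN1r addNr.
have [h -> hP] := tens_monomials w => t0; suff -> : h = 0 by rewrite raddf0.
apply/malgP => v; rewrite mcoeff0; apply/eqP; rewrite mcoeff_eq0; apply/negP => vh.
have {}vP i : {a | g (v i) = lmon K a} by apply: cid; exact: hP.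
have := coef_monomials (al := fun i => sval (vP i)) hP (fun i => svalP (vP i)).
by rewrite t0 => /esym/eqP; rewrite mcoeff_eq0 vh.
Qed.

Lemma coef_support t al : coef al t != 0 -> forall i, exists w, g w = lmon K (al i).
Proof.
move=> alt i; apply: contrapT => no; move/eqP: alt; apply.
elim/tens_ind: t => [|c v t IH]; first exact: (lin0 (coef_linear al)).
rewrite coef_linear IH coef_pure (bigD1 i) //= mcoeff_outdom ?mul0r ?scaler0 ?addr0 //.
by apply/negP => /g_mon.
Qed.

End TensorCoefficients.
(** * The dual of a shifted graded algebra *)

Section ShiftDual.
Variables (K : fieldType) (R : gradedAlg K) (a j : int).
Local Notation A := (zgalg_of R).
Local Notation M := (shift (regular A) a).

Lemma mul_hom_deg delta (e : delta + a = j) k : delta + (a + k) = k + j.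
Proof. lia. Qed.

Definition mul_hom delta (e : delta + a = j) (r : A delta) : dual M j.
Proof.
refine (@ZHom K A M (regular A) j (fun k y => zmul (mul_hom_deg e k) r y) _ _).
- by move=> k; exact: zmul_linr.
- by move=> i k l e1 e2 x y; apply: val_inj; rewrite /= mulrCA.
Defined.

Lemma one_subproof : (1 : R) \in hcomp R (a + - a).
Proof. by rewrite subrr hcomp1. Qed.

(** The generator of R(a), which has degree -a. *)
Definition shift_one : M (- a) := Sub 1 one_subproof : hpiece R (a + - a).

(** As y is y times the generator, a linear map is multiplication by its value
    at the generator. *)
Lemma dual_shiftE (phi : dual M j) k (y : M k) :
  val (phi k y : hpiece R _) =
  val (y : hpiece R _) * val (phi _ shift_one : hpiece R _).
Proof.
have e : (a + k) + - a = k by lia.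
have e' : (a + k) + (- a + j) = k + j by lia.
have -> : y = @zact _ _ M _ _ _ e (y : A (a + k)) shift_one.
  by apply: val_inj; rewrite /= mulr1.
by rewrite (zhom_act phi e e') /= mulr1.
Qed.

End ShiftDual.

Section DualMonomials.
Variables (K : fieldType) (R : gradedAlg K) (d : nat).
Variable f : {lrmorphism R -> laurent K d}.
Hypothesis f_inj : injective f.
Hypothesis f_hsupp : forall n x a, x \in hcomp R n -> a \in msupp (f x) ->
  has_monomial f n a.

Definition piece_laurent n (x : hpiece R n) : laurent K d := f (val x).

Lemma piece_laurent_linear n : linear (@piece_laurent n).
Proof. by move=> c x y; rewrite /piece_laurent linearP. Qed.

Lemma piece_laurent_inj n : injective (@piece_laurent n).
Proof. by move=> x y /f_inj/val_inj. Qed.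

Lemma has_monomial_piece n b : has_monomial f n b ->
  exists w : hpiece R n, piece_laurent w = lmon K b.
Proof. by move=> [x xn fx]; exists (Sub x xn). Qed.

Lemma piece_has_monomial n b (w : hpiece R n) :
  piece_laurent w = lmon K b -> has_monomial f n b.
Proof. by exists (val w); first exact: valP. Qed.

Lemma piece_laurent_mon n (x : hpiece R n) b : b \in msupp (piece_laurent x) ->
  exists w : hpiece R n, piece_laurent w = lmon K b.
Proof.
by move=> bx; apply/has_monomial_piece/f_hsupp/bx; exact: valP.
Qed.

Variables a j : int.
Local Notation A := (zgalg_of R).
Local Notation M := (shift (regular A) a).

(** The Laurent polynomial by which phi multiplies. *)
Definition dual_laurent (phi : dual M j) : laurent K d :=
  piece_laurent (phi _ (shift_one R a) : hpiece R _).

Lemma dual_laurent_linear : linear dual_laurent.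
Proof.
move=> c phi psi; rewrite /dual_laurent zhomDE zhomZE.
exact: piece_laurent_linear.
Qed.

Lemma dual_laurentE (phi : dual M j) k (y : M k) :
  piece_laurent (phi k y : hpiece R _) =
  piece_laurent (y : hpiece R _) * dual_laurent phi.
Proof. by rewrite /piece_laurent dual_shiftE rmorphM. Qed.

Lemma dual_laurent_inj : injective dual_laurent.
Proof.
move=> phi psi E; apply: zhomP => k y; apply: (@piece_laurent_inj (k + j)).
by rewrite !dual_laurentE E.
Qed.

Lemma has_monomial_dual delta b : delta + a = j -> has_monomial f delta b ->
  exists phi : dual M j, dual_laurent phi = lmon K b.
Proof.
move=> e [x xd fx]; exists (mul_hom e (Sub x xd : hpiece R delta)).
by rewrite /dual_laurent /piece_laurent /= mulr1.
Qed.

Lemma dual_laurent_mon (phi : dual M j) b : b \in msupp (dual_laurent phi) ->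
  exists psi : dual M j, dual_laurent psi = lmon K b.
Proof.
have e : - a + j + a = j by lia.
move=> bphi; apply/(has_monomial_dual e)/f_hsupp/bphi; exact: valP.
Qed.

End DualMonomials.

(** * The natural map for a family of saturated toric rings *)

Section SegreDual.
Variables (K : fieldType) (I : finType) (R : I -> gradedAlg K) (d : I -> nat).
Variable f : forall i, {lrmorphism R i -> laurent K (d i)}.
Hypothesis fP : forall i, saturated_embedding (f i).

Let f_inj i : injective (f i).
Proof. by case: (fP i). Qed.
Let f_hsupp i n x b : x \in hcomp (R i) n -> b \in msupp (f i x) ->
  has_monomial (f i) n b.
Proof. by case: (fP i) => _ H _ _; exact: H. Qed.
Let f_all i n : 0 <= n -> exists b, has_monomial (f i) n b.
Proof. by case: (fP i) => _ _ H _; exact: H. Qed.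
Let f_sat i (n0 : int) (u : 'cV[int]_(d i)) (delta : int) :
  (forall n z, n0 <= n -> has_monomial (f i) n z ->
     has_monomial (f i) (n + delta) (u + z)) ->
  has_monomial (f i) delta u.
Proof. by case: (fP i) => _ _ _ H; exact: H. Qed.

Local Notation A := (fun i => zgalg_of (R i)).
Implicit Types al be : forall i, 'cV[int]_(d i).

Definition piece_coef (n : I -> int) al : tens (fun i => A i (n i)) -> K^o :=
  coef (fun i => @piece_laurent_linear K (R i) (d i) (f i) (n i)) al.

Definition famD al be : forall i, 'cV[int]_(d i) := fun i => al i + be i.

Lemma piece_inj (n : I -> int) i : injective (@piece_laurent K (R i) (d i) (f i) (n i)).
Proof. exact/piece_laurent_inj/f_inj. Qed.

Lemma piece_mon (n : I -> int) i (y : hpiece (R i) (n i)) b :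
  b \in msupp (piece_laurent (f i) y) ->
  exists w : hpiece (R i) (n i), piece_laurent (f i) w = lmon K b.
Proof. exact/piece_laurent_mon/f_hsupp. Qed.

Lemma piece_coef_mul p q r (e : p + q = r) al be (x : forall i, A i p)
    (t : segre_alg A q) :
  (forall i, piece_laurent (f i) (x i : hpiece (R i) p) = lmon K (al i)) ->
  piece_coef (n := fun=> r) (famD al be) (segre_mul e (tpure x) t) =
  piece_coef (n := fun=> q) be t.
Proof.
move=> xal; move: t; apply: tens_ext.
- exact: (comp_linear (coef_linear _ _) (segre_linr e _)).
- exact: coef_linear.
move=> v; rewrite /= /segre_mul tmap2_pure /piece_coef !coef_pure.
apply: eq_bigr => i _.
by rewrite /piece_laurent /= rmorphM /= [f i _]xal mcoeff_lmonM.
Qed.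

Variables (a : I -> int) (j : int).
Local Notation M := (fun i => shift (regular (A i)) (a i)).

Definition dual_coef al : tens (fun i => dual (M i) j) -> K^o :=
  coef (fun i => @dual_laurent_linear K (R i) (d i) (f i) (a i) j) al.

(** At a monomial tensor, the natural map shifts the coefficients of a tensor of
    duals by the exponents of the monomial. Both injectivity and the
    verification of a preimage rest on this. *)
Lemma natmap_coef k al be (t : segre (fun i => dual (M i)) j) (x : forall i, M i k) :
  (forall i, piece_laurent (f i) (x i : hpiece (R i) _) = lmon K (al i)) ->
  piece_coef (n := fun=> k + j) (famD al be) (natmap t k (tpure x)) = dual_coef be t.
Proof.
move=> xal; move: t; apply: tens_ext.
- move=> c t u; rewrite natmap_linear zhomDE zhomZE; exact: coef_linear.
- exact: coef_linear.
move=> phi; rewrite natmapE /piece_coef /dual_coef !coef_pure.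
apply: eq_bigr => i _.
by rewrite dual_laurentE xal mcoeff_lmonM.
Qed.

Lemma degree_bound : exists B : int, forall i, - B <= a i <= B.
Proof.
exists (\sum_i `|a i|) => i; rewrite -ler_norml (bigD1 i) //=.
by rewrite lerDl sumr_ge0.
Qed.

(** Every element of the dual of the Segre product behaves as multiplication by a
    fixed Laurent polynomial. Choosing monomials w_i of R_i of degree B - a_i,
    the elements p = z w and p' = x w of the Segre product of the algebras
    satisfy p x = p' z. *)
Lemma dual_segre_coef (phi : dual (segre M) j) k l al be ga
    (x : forall i, M i k) (z : forall i, M i l) :
  (forall i, piece_laurent (f i) (x i : hpiece (R i) _) = lmon K (al i)) ->
  (forall i, piece_laurent (f i) (z i : hpiece (R i) _) = lmon K (be i)) ->
  piece_coef (n := fun=> k + j) (famD al ga) (phi k (tpure x)) =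
  piece_coef (n := fun=> l + j) (famD be ga) (phi l (tpure z)).
Proof.
move=> xal zbe; have [B aB] := degree_bound.
have wP i : {b & {w : hpiece (R i) (B - a i) | piece_laurent (f i) w = lmon K b}}.
  have B_ge : 0 <= B - a i by case/andP: (aB i); lia.
  have [b bP] := cid (f_all i B_ge); exists b; apply: cid.
  exact: has_monomial_piece.
pose eta i := tag (wP i); pose w i := sval (tagged (wP i)).
have weta i : piece_laurent (f i) (w i) = lmon K (eta i) := svalP (tagged (wP i)).
have dl i : (a i + l) + (B - a i) = B + l by lia.
have dk i : (a i + k) + (B - a i) = B + k by lia.
pose p : forall i, A i (B + l) := fun i => @zmul K (A i) _ _ _ (dl i) (z i) (w i).
pose p' : forall i, A i (B + k) := fun i => @zmul K (A i) _ _ _ (dk i) (x i) (w i).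
have pE i : piece_laurent (f i) (p i : hpiece (R i) _) = lmon K (famD be eta i).
  by rewrite /piece_laurent /= rmorphM /famD lmonD -weta -zbe.
have p'E i : piece_laurent (f i) (p' i : hpiece (R i) _) = lmon K (famD al eta i).
  by rewrite /piece_laurent /= rmorphM /famD lmonD -weta -xal.
have e1 : (B + l) + k = B + k + l by lia.
have e2 : (B + k) + l = B + k + l by lia.
have e1' : (B + l) + (k + j) = B + k + l + j by lia.
have e2' : (B + k) + (l + j) = B + k + l + j by lia.
have px : @zact _ _ (segre M) _ _ _ e1 (tpure p : segre_alg A _) (tpure x) =
          @zact _ _ (segre M) _ _ _ e2 (tpure p' : segre_alg A _) (tpure z).
  rewrite /= !segre_act_pure; congr tpure; apply: functional_extensionality_dep => i.
  by apply: val_inj; rewrite /= mulrAC [RHS]mulrAC; congr (_ * _); rewrite mulrC.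
have := congr1 (phi _) px.
rewrite (zhom_act phi e1 e1') (zhom_act phi e2 e2').
move=> /(congr1 (piece_coef (n := fun=> B + k + l + j)
                   (famD (famD be eta) (famD al ga)))).
rewrite [X in X = _](piece_coef_mul e1' _ _ pE).
have -> : famD (famD be eta) (famD al ga) = famD (famD al eta) (famD be ga).
  apply: functional_extensionality_dep => i.
  by rewrite /famD addrACA [RHS]addrACA [be i + _]addrC.
by rewrite [X in _ = X](piece_coef_mul e2' _ _ p'E).
Qed.

Lemma exists_monomial_family k : (forall i, 0 <= a i + k) ->
  exists al (x : forall i, M i k),
    forall i, piece_laurent (f i) (x i : hpiece (R i) _) = lmon K (al i).
Proof.
move=> ak.
have xP i : {b & {w : hpiece (R i) (a i + k) | piece_laurent (f i) w = lmon K b}}.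
  have [b bP] := cid (f_all i (ak i)); exists b; apply: cid.
  exact: has_monomial_piece.
exists (fun i => tag (xP i)), (fun i => sval (tagged (xP i))) => i.
exact: svalP (tagged (xP i)).
Qed.

Lemma natmap_injective : injective (@natmap K I A M j).
Proof.
move=> t t' tt'.
apply: (coef_ext (gL := fun i => @dual_laurent_linear K (R i) (d i) (f i) (a i) j)).
- by move=> i; apply: dual_laurent_inj.
- by move=> i phi b; apply/dual_laurent_mon/f_hsupp.
move=> be; have [B aB] := degree_bound.
have [|al [x xal]] := @exists_monomial_family B.
  by move=> i; case/andP: (aB i); lia.
by rewrite -[LHS](natmap_coef _ _ xal) -[RHS](natmap_coef _ _ xal) tt'.
Qed.

(** Each exponent that occurs in phi(x) / x belongs factorwise to the rings R_i:
    translation by u_i = ep_i - al_i preserves the monomials of R_i of large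
    degree, since a monomial of R_i can be completed to a monomial tensor, and
    saturation applies. *)
Lemma monomial_quotient (phi : dual (segre M) j) k al ep
    (x : forall i, M i k) :
  (forall i, piece_laurent (f i) (x i : hpiece (R i) _) = lmon K (al i)) ->
  piece_coef (n := fun=> k + j) ep (phi k (tpure x)) != 0 ->
  forall i, has_monomial (f i) (j - a i) (ep i - al i).
Proof.
move=> xal ep_neq0 i; have [B aB] := degree_bound.
(* For n >= B + a_i the degree l = n - a_i is at least B, so that every factor
   has a monomial in the degree a_s + l. *)
apply: (f_sat (n0 := B + a i)) => n b Bn nb; pose l := n - a i.
have l_ge s : 0 <= a s + l by rewrite /l; case/andP: (aB s); lia.
have [be0 [z0 zbe0]] := exists_monomial_family l_ge.
have {}nb : has_monomial (f i) (a i + l) b by rewrite /l addrC subrK.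
have [zi zib] := has_monomial_piece nb.
pose be := dfwith be0 b.
pose z := @dfwith I (fun s => M s l) z0 i zi.
have zbe s : piece_laurent (f s) (z s : hpiece (R s) _) = lmon K (be s).
  by rewrite /z /be; case: (eqVneq i s) => [is_|is_];
    [subst s; rewrite !dfwith_in|rewrite !dfwith_out].
pose u : forall s, 'cV[int]_(d s) := fun s => ep s - al s.
have epE : ep = famD al u.
  by apply: functional_extensionality_dep => s; rewrite /famD /u addrC subrK.
move: ep_neq0; rewrite epE (dual_segre_coef phi _ xal zbe) => cz_neq0.
have [w wE] := coef_support
  (gL := fun i => @piece_laurent_linear K (R i) (d i) (f i) (l + j))
  (piece_mon (n := fun=> l + j)) cz_neq0 i.
have := piece_has_monomial wE.
have -> : famD al u i - al i = u i by rewrite /famD addrAC subrr add0r.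
rewrite /famD /be dfwith_in [b + _]addrC.
by congr has_monomial; rewrite /l; lia.
Qed.

(** Writing phi(x) at one monomial tensor x as a combination of monomial tensors
    v, each quotient v / x is a tensor of multiplication maps; their combination
    t agrees with phi at x, hence everywhere, as both are determined by their
    coefficients at x. *)
Lemma natmap_surjective (phi : dual (segre M) j) : exists t, @natmap K I A M j t = phi.
Proof.
have [B aB] := degree_bound.
have [|al [x xal]] := @exists_monomial_family B.
  by move=> i; case/andP: (aB i); lia.
have [h hE hP] := tens_monomials
  (fun i => @piece_laurent_linear K (R i) (d i) (f i) (B + j))
  (piece_inj (n := fun=> B + j)) (piece_mon (n := fun=> B + j)) (phi B (tpure x)).
have psiP (v : forall i, A i (B + j)) i : exists psi : dual (M i) j,
    v \in msupp h -> piece_laurent (f i) (v i : hpiece (R i) _) =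
                     lmon K (al i) * dual_laurent (f i) psi.
  case: (boolP (v \in msupp h)) => vh; last by exists 0.
  have epP s := cid (hP v vh s); pose ep s := sval (epP s).
  have vep s : piece_laurent (f s) (v s : hpiece (R s) _) = lmon K (ep s) :=
    svalP (epP s).
  have ep_neq0 : piece_coef (n := fun=> B + j) ep (phi B (tpure x)) != 0.
    rewrite hE /piece_coef (coef_monomials _ (piece_inj (n := fun=> B + j)) hP vep).
    by rewrite mcoeff_neq0.
  have := monomial_quotient xal ep_neq0 i.
  have e : j - a i + a i = j by lia.
  move=> /(has_monomial_dual e)[psi psiE]; exists psi => _.
  by rewrite psiE vep -lmonD addrC subrK.
pose psi v i := sval (cid (psiP v i)).
pose t : segre (fun i => dual (M i)) j := \sum_(v <- msupp h) h@_v *: tpure (psi v).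
have t_coef ga : dual_coef ga t =
    piece_coef (n := fun=> B + j) (famD al ga) (phi B (tpure x)).
  rewrite hE /piece_coef coef_tpi.
  rewrite [LHS](linear_comb (coef_linear _ ga)).
  apply: eq_big_seq => v vh; rewrite coef_pure; congr (_ * _).
  by apply: eq_bigr => i _; rewrite (svalP (cid (psiP v i)) vh) mcoeff_lmonM.
exists t; apply: zhomP => k.
apply: (tens_monomial_ext
  (fun i => @piece_laurent_linear K (R i) (d i) (f i) (a i + k))
  (piece_inj (n := fun i => a i + k)) (piece_mon (n := fun i => a i + k))).
- exact: (@zhom_lin _ _ _ _ _ (natmap t)).
- exact: (@zhom_lin _ _ _ _ _ phi).
move=> y yP; have beP s := cid (yP s); pose be s := sval (beP s).
have ybe s : piece_laurent (f s) (y s : hpiece (R s) _) = lmon K (be s) :=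
  svalP (beP s).
apply: (coef_ext
  (gL := fun i => @piece_laurent_linear K (R i) (d i) (f i) (k + j))
  (piece_inj (n := fun=> k + j)) (piece_mon (n := fun=> k + j))) => de.
pose ga : forall s, 'cV[int]_(d s) := fun s => de s - be s.
have -> : de = famD be ga.
  by apply: functional_extensionality_dep => s; rewrite /famD /ga addrC subrK.
rewrite [LHS](natmap_coef ga t ybe) [RHS](dual_segre_coef phi ga ybe xal).
exact: t_coef.
Qed.

Lemma natmap_bijective : bijective (@natmap K I A M j).
Proof.
pose inv phi := sval (cid (natmap_surjective phi)).
have invK : cancel inv (@natmap K I A M j) by move=> phi; rewrite /inv; case: (cid _).
by exists inv => // t; apply: natmap_injective; exact: invK.
Qed.

End SegreDual.
Theorem theorem1p6 (K : fieldType) (m : nat) (R : 'I_m -> gradedAlg K)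
    (m_gt0 : (0 < m)%N)
    (R_standard : forall i : 'I_m, standard_graded (R i))
    (R_toric : forall i : 'I_m, toric (R i))
    (R_depth : forall i : 'I_m, depth_ge (R i) 2) :
  friendly R.
Proof.
have emb i := cid (toric_depth2_saturated (R_toric i) (R_depth i)).
have fP i := svalP (cid (svalP (emb i))).
move=> a j; exact: (natmap_bijective fP).
Qed.
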